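(* Let $R$ be an integral domain, and let $M$ be a reduced torsion-free commutative cancellative monoid satisfying ACCP. Then $R$ is weak-ACCP if and only if the monoid ring $R[M]$ is weak-ACCP.
   Context: Monoids are commutative and cancellative, written additively. A monoid $M$ is reduced if its only invertible element is $0$; it is torsion-free if for all $b,c\in M$ and $n\in\mathbb{N}$ (positive integers), $nb=nc$ implies $b=c$; it satisfies ACCP if every ascending chain of principal ideals (sets of the form $b+M$) eventually stabilizes. $R[M]$ is the monoid ring of polynomial expressions $\sum_i r_i X^{m_i}$ with coefficients $r_i\in R$ and exponents $m_i\in M$; it is an integral domain when $R$ is an integral domain and $M$ is torsion-free. An integral domain $R$ is atomic if every nonzero nonunit of $R$ is a finite product of irreducibles. An element $x\in R$ satisfies ACCP (in $R$) if every ascending chain of principal ideals of $R$ starting at $Rx$ eventually stabilizes. An integral domain $R$ is weak-ACCP if it is atomic and every nonempty finite subset $S$ of $R\setminus\{0\}$ has a common divisor $d\in R$ such that $\frac{s}{d}$ satisfies ACCP in $R$ for some $s\in S$. *)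

(* Defs.v *)
From HB Require Import structures.
From mathcomp Require Import all_boot all_algebra.
From mathcomp Require Import finmap.
From mathcomp Require Import classical_sets.
From mathcomp Require Export monalg.

Set Implicit Arguments.
Unset Strict Implicit.
Unset Printing Implicit Defensive.

Import GRing.Theory.

Local Open Scope ring_scope.
Local Open Scope classical_set_scope.

(* A [conomType] is a commutative monoid, written multiplicatively, and it is
   reduced by definition: its axiom [unitm] says that x * y = 1 forces x = 1
   and y = 1. The monoid ring R[M] is [{malg R[M]}]; the monomial X^m is
   [<< m >>]. *)

Section Monoids.
Variable M : conomType.
Implicit Types b c : M.

Definition mpow b (n : nat) : M := iter n (mmul b) mone.

Definition mcancellative : Prop := forall b, injective (mmul b).

Definition mtorsion_free : Prop :=
  forall b c (n : nat), (0 < n)%N -> mpow b n = mpow c n -> b = c.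

Definition mprincipal b : set M := range (mmul b).

Definition maccp : Prop :=
  forall a : nat -> M,
    (forall n, mprincipal (a n) `<=` mprincipal (a n.+1)) ->
  exists N, forall n, (N <= n)%N -> mprincipal (a n) = mprincipal (a N).

End Monoids.

Arguments mcancellative : clear implicits.
Arguments mtorsion_free : clear implicits.
Arguments maccp : clear implicits.

(* Ring notions are stated over [comNzRingType] because [{malg R[M]}] carries
   neither a [unitRingType] nor an [idomainType] instance: whether it is a
   domain depends on M. *)

Section Rings.
Variable A : comNzRingType.
Implicit Types (x y d s t : A) (S : {fset A}).

Definition is_unit x : Prop := exists y, y * x = 1.

Definition divides d x : Prop := exists t, x = t * d.

Definition irreducible x : Prop :=
  [/\ x <> 0, ~ is_unit x
    & forall y z, x = y * z -> is_unit y \/ is_unit z].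

Definition atomic : Prop :=
  forall x, x <> 0 -> ~ is_unit x ->
  exists2 fs : seq A, {in fs, forall f, irreducible f} & x = \prod_(f <- fs) f.

Definition rprincipal x : set A := range (fun r => r * x).

Definition accp_elt x : Prop :=
  forall a : nat -> A,
    rprincipal (a 0%N) = rprincipal x ->
    (forall n, rprincipal (a n) `<=` rprincipal (a n.+1)) ->
  exists N, forall n, (N <= n)%N -> rprincipal (a n) = rprincipal (a N).

(* In the last clause t is the quotient s / d, which is unique because A is a
   domain and s, hence d, is nonzero. *)
Definition weak_accp : Prop :=
  [/\ GRing.integral_domain_axiom A,
      atomic
    & forall S, S != fset0 -> 0 \notin S ->
      exists d, {in S, forall s, divides d s} /\
        exists s t, [/\ s \in S, s = t * d & accp_elt t]].

End Rings.

Arguments atomic : clear implicits.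
Arguments weak_accp : clear implicits.

Lemma is_unitP (A : comUnitRingType) (x : A) :
  reflect (is_unit x) (x \is a GRing.unit).
Proof.
apply: (iffP idP) => [xU|[y yx]]; first by exists x^-1; rewrite mulVr.
by apply/unitrP; exists y; split; rewrite // mulrC.
Qed.

(* Main.v *)
Require Import Defs.
From mathcomp Require Import all_boot all_algebra.
From mathcomp Require Import finmap.
From mathcomp Require Import boolp classical_sets.

(** Choose a total order on M compatible with its operation; one exists because
    M is cancellative and torsion-free ([total_monoid_order]). As R is a domain,
    the greatest monomial of a product is the product of the greatest monomials
    of the factors, and likewise for the least ([extremalM]). Hence R[M] is a
    domain, and since M is reduced, both factors of a nonzero constant are
    constants ([malg_mul_const]). Units, irreducibles, divisibility and
    factorizations of a constant are therefore the same in R and in R[M], so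
    that R inherits weak-ACCP from R[M] ([weak_accp_coef]).

    The converse rests on one transfer principle ([accp_elt_coef]): an element g
    of R[M] satisfies ACCP as soon as one of its nonzero coefficients s does in
    R. Let a_0, a_1, ... be a chain of successive divisors starting at a divisor
    of g. The greatest monomials of the a_n form a chain of divisors in M, which
    stabilizes by ACCP, and so do the least ones; from some N on, the quotients
    a_n / a_(n+1) have the identity of M as greatest and least monomial, so they
    are constants.
    Writing g = k a_N, the coefficients of k a_n at the exponent of s then form a
    chain of divisors of s in R with the very same quotients. It stabilizes, so
    these quotients are eventually units.

    Given finitely many nonzero elements of R[M], apply weak-ACCP of R to the set
    of all their coefficients: this gives d in R dividing every coefficient, with
    one of the quotients satisfying ACCP. Dividing by d the element that this
    coefficient comes from leaves an element of R[M] that satisfies ACCP by the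
    transfer principle ([weak_accp_content]).
    For atomicity, take a single f = d g: the constant d factors already in R,
    and g factors because it satisfies ACCP ([accp_factorable]). *)

Set Implicit Arguments.
Unset Strict Implicit.
Unset Printing Implicit Defensive.

Import GRing.Theory.

Local Open Scope ring_scope.

Local Notation "1" := (@mone _) : monom_scope.
Local Notation "x * y" := (mmul x y) : monom_scope.

(** * Total orders on cancellative torsion-free monoids *)

Section MonoidOrders.
Variable M : conomType.
Hypothesis M_canc : mcancellative M.
Hypothesis M_tf : mtorsion_free M.
Implicit Types (le : M -> M -> Prop) (a b x y z : M).
Local Open Scope monom_scope.

Lemma mpowD b n m : mpow b (n + m) = mpow b n * mpow b m.
Proof. by elim: n => [|n IHn]; rewrite ?mul1m // addSn /= IHn mulmA. Qed.

Lemma mpowM b n m : mpow b (n * m) = mpow (mpow b n) m.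
Proof. by elim: m => [|m IHm]; rewrite ?muln0 // mulnS mpowD IHm. Qed.

Lemma mmulACA x y x' y' : (x * y) * (x' * y') = (x * x') * (y * y').
Proof. exact: Monoid.mulmACA. Qed.

(** Reflexivity is left out so that the union of an empty chain, that is the
    empty relation, is a monoid order: Zorn's lemma then applies without a
    special case, and a maximal relation turns out to be reflexive. *)
Record monoid_order le : Prop := MonoidOrder {
  mo_anti : forall x y, le x y -> le y x -> x = y;
  mo_trans : forall y x z, le x y -> le y z -> le x z;
  mo_mul : forall z x y, le x y -> le (z * x) (z * y);
  mo_div : forall z x y, le (z * x) (z * y) -> le x y }.

Lemma monoid_order_dual le :
  monoid_order le -> monoid_order (fun x y => le y x).
Proof.
case=> anti trans mul div; split=> [x y /[swap]|y x z /[swap]|z x y|z x y].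
- exact: anti.
- exact: trans.
- exact: mul.
- exact: div.
Qed.

Lemma monoid_order_mul2 le x y x' y' : monoid_order le ->
  le x y -> le x' y' -> le (x * x') (y * y').
Proof.
move=> leO xy xy'; apply: (mo_trans leO (mo_mul leO x xy')).
by rewrite mulmC [_ * y']mulmC; apply: (mo_mul leO).
Qed.

(** Without reflexivity, the case n = 0 could fail. *)
Lemma monoid_order_pow le x y n : monoid_order le ->
  le x y -> (0 < n)%N -> le (mpow x n) (mpow y n).
Proof.
move=> leO xy; case: n => // n _; elim: n => [|n IHn]; first by rewrite /= !mulm1.
exact: (monoid_order_mul2 leO).
Qed.

Lemma monoid_order_refl le :
  monoid_order le -> monoid_order (fun x y => x = y \/ le x y).
Proof.
move=> leO; split.
- by move=> x y [//|xy] [//|yx]; apply: (mo_anti leO).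
- move=> y x z [->//|xy] [<-|yz]; first by right.
  by right; apply: (mo_trans leO xy).
- by move=> z x y [->|xy]; [left|right; apply: (mo_mul leO)].
- by move=> z x y [/M_canc->|xy]; [left|right; apply: (mo_div leO xy)].
Qed.

(** In the group of fractions, written additively, this says that y - x lies in
    the positive cone of [le] enlarged by the multiples of b - a: for
    reflexive [le] it is the least enlargement in which a is below b. *)
Definition adjoin_le le a b x y :=
  exists n, le (x * mpow b n) (y * mpow a n).

(** The enlarged cone can fail to be pointed only if some positive multiple of
    a - b was already nonnegative. *)
Lemma monoid_order_adjoin le a b : monoid_order le ->
  ~ (exists2 k, (0 < k)%N & le (mpow b k) (mpow a k)) ->
  monoid_order (adjoin_le le a b).
Proof.
move=> leO nle; split.
- move=> x y [n xy] [m yx].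
  have: le (mpow b (n + m)) (mpow a (n + m)).
    apply: (mo_div leO (z := x * y)); rewrite !mpowD.
    rewrite [X in le _ (X * _)]mulmC (mmulACA x) (mmulACA y).
    exact: (monoid_order_mul2 leO).
  case: (posnP (n + m)%N) => [/eqP|nm0 ba]; last by case: nle; exists (n + m)%N.
  rewrite addn_eq0 => /andP[/eqP n0 /eqP m0] _; move: xy yx.
  by rewrite n0 m0 !mulm1; apply: (mo_anti leO).
- move=> y x z [n xy] [m yz]; exists (m + n)%N; rewrite !mpowD.
  rewrite [mpow b m * _]mulmC !mulmA.
  apply: (mo_trans leO (y := mpow b m * (y * mpow a n))).
    by rewrite mulmC; apply: (mo_mul leO).
  by rewrite mulmA ![_ * mpow a n]mulmC [mpow b m * y]mulmC; apply: (mo_mul leO).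
- by move=> z x y [n xy]; exists n; rewrite -!mulmA; apply: (mo_mul leO).
- by move=> z x y [n]; rewrite -!mulmA => /(mo_div leO) xy; exists n.
Qed.

(** A maximal monoid order is total: if neither a <= b nor b <= a can be
    adjoined, then b^k <= a^k and a^j <= b^j for some positive k and j, so
    b^(kj) = a^(kj), and a = b by torsion-freeness. *)
Lemma total_monoid_order :
  exists2 le, monoid_order le & forall x y, le x y \/ le y x.
Proof.
pose rel_of (A : set (M * M)) x y := A (x, y).
have [F FO Ftot|A [AO Amax]] :=
    @Zorn_bigcup (M * M)%type [set A | monoid_order (rel_of A)].
  have join x y x' y' : (\bigcup_(X in F) X)%classic (x, y) ->
      (\bigcup_(X in F) X)%classic (x', y') ->
      exists2 X, F X & X (x, y) /\ X (x', y').
    move=> [X FX Xxy] [Y FY Yxy']; have [XY|YX] := Ftot _ _ FX FY.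
      by exists Y => //; split=> //; apply: XY.
    by exists X => //; split=> //; apply: YX.
  split.
  - move=> x y xy yx; have [X /FO XO [Xxy Xyx]] := join _ _ _ _ xy yx.
    exact: (mo_anti XO).
  - move=> y x z xy yz; have [X FX [Xxy Xyz]] := join _ _ _ _ xy yz.
    by exists X => //; apply: (mo_trans (FO _ FX) Xxy Xyz).
  - by move=> z x y [X FX Xxy]; exists X => //; apply: (mo_mul (FO _ FX)).
  - by move=> z x y [X FX Xxy]; exists X => //; apply: (mo_div (FO _ FX) Xxy).
have {}Amax le : monoid_order le -> (forall x y, A (x, y) -> le x y) ->
    forall x y, le x y -> A (x, y).
  move=> leO Ale x y xy; apply: contrapT => nAxy.
  apply: (Amax [set p | le p.1 p.2]%classic) => //; split; first by case.
  by move/(_ (x, y) xy).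
have Arefl x : A (x, x).
  apply: (Amax _ (monoid_order_refl AO)); last by left.
  by move=> y z; right.
exists (rel_of A) => // a b.
have adj c d : ~ (exists2 k, (0 < k)%N & rel_of A (mpow d k) (mpow c k)) ->
    rel_of A c d.
  move=> ncd; apply: (Amax _ (monoid_order_adjoin AO ncd)).
    by move=> x y xy; exists 0%N; rewrite !mulm1.
  by exists 1%N; rewrite /= !mulm1 mulmC; apply: Arefl.
have [[k k0 ba]|/adj] := pselect
  (exists2 k, (0 < k)%N & rel_of A (mpow b k) (mpow a k)); last by left.
have [[j j0 ab]|/adj] := pselect
  (exists2 j, (0 < j)%N & rel_of A (mpow a j) (mpow b j)); last by right.
left; suff -> : a = b by apply: Arefl.
apply: (M_tf (n := (k * j)%N)); first by rewrite muln_gt0 k0.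
apply: (mo_anti AO); last by rewrite !mpowM; apply: (monoid_order_pow AO).
by rewrite mulnC !mpowM; apply: (monoid_order_pow AO).
Qed.

(** In a reduced cancellative monoid, generators of the same principal ideal
    coincide, so a chain of ideals that stabilizes has stable generators. *)
Lemma maccp_stable (t : nat -> M) : maccp M ->
  (forall n, exists u, t n = t n.+1 * u) ->
  exists N, forall n, (N <= n)%N -> t n.+1 = t n.
Proof.
move=> M_accp t_dec; have [|N tN] := M_accp t.
  move=> n _ [v _ <-]; have [u ->] := t_dec n.
  by exists (u * v); rewrite ?mulmA.
exists N => n Nn.
have : mprincipal (t n) (t n.+1).
  rewrite (tN _ Nn) -(tN n.+1 (leqW Nn)); exists 1 => //; exact: mulm1.
case=> v _ tv; have [u tu] := t_dec n; rewrite -tv.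
suff [_ ->] : u = 1 /\ v = 1 by rewrite mulm1.
apply: unitm; apply: (M_canc (b := t n.+1)).
by rewrite mulm1 mulmA -tu.
Qed.

End MonoidOrders.

(** * Divisibility, ACCP and factorizations in commutative rings *)

Section Divisibility.
Variable A : comNzRingType.
Implicit Types (x y z d s t : A).

Lemma divides_refl x : divides x x.
Proof. by exists 1; rewrite mul1r. Qed.

Lemma divides_trans y x z : divides x y -> divides y z -> divides x z.
Proof. by move=> [s ->] [t ->]; exists (t * s); rewrite mulrA. Qed.

Lemma rprincipalP x y : (rprincipal x `<=` rprincipal y)%classic <-> divides y x.
Proof.
split=> [xy|[t ->] _ [r _ <-]]; last by exists (r * t); rewrite ?mulrA.
by have [|t _ <-] := xy x; [exists 1; rewrite ?mul1r|exists t].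
Qed.

(** ACCP at x in terms of divisors; letting the chain start at any divisor of x
    costs nothing, since x itself can be put in front. *)
Lemma accp_eltP x : accp_elt x <->
  forall a : nat -> A, divides (a 0%N) x ->
    (forall n, divides (a n.+1) (a n)) ->
  exists N, forall n, (N <= n)%N -> divides (a n) (a n.+1).
Proof.
split=> [x_accp a ax a_dec|x_stable a ax a_inc].
  have [//||N aN] := x_accp (fun n => if n is n'.+1 then a n' else x).
    by case=> [|n]; apply/rprincipalP.
  exists N => n Nn; apply/rprincipalP.
  by have := (aN n.+1 (leqW Nn), aN n.+2 (leqW (leqW Nn))) => -[/= -> ->].
have [||N aN] := x_stable a.
- by apply/rprincipalP; rewrite ax.
- by move=> n; apply/rprincipalP.
exists N => n /subnK<-; elim: (n - N)%N => // k <-.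
apply/seteqP; split; first by apply/rprincipalP/aN; rewrite leq_addl.
exact: a_inc.
Qed.

Lemma is_unit1 : is_unit (1 : A).
Proof. by exists 1; rewrite mul1r. Qed.

Lemma is_unitM x y : is_unit x -> is_unit y -> is_unit (x * y).
Proof. by move=> [s sx] [t ty]; exists (s * t); rewrite mulrACA sx ty mulr1. Qed.

Lemma is_unit_mull x y : is_unit (x * y) -> is_unit x.
Proof. by move=> [t txy]; exists (t * y); rewrite -mulrA [y * x]mulrC. Qed.

Lemma is_unit_mulr x y : is_unit (x * y) -> is_unit y.
Proof. by rewrite mulrC; apply: is_unit_mull. Qed.

Lemma irreducible_mul_unit u x : is_unit u -> irreducible x -> irreducible (u * x).
Proof.
move=> [v vu] [x0 nux irrx].
have vuK z : v * (u * z) = z by rewrite mulrA vu mul1r.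
split=> [ux0|/is_unit_mulr//|y z uxyz].
  by apply: x0; rewrite -(vuK x) ux0 mulr0.
have [|/is_unit_mulr|] := irrx (v * y) z; [|by left|by right].
by rewrite -mulrA -uxyz vuK.
Qed.

(** The unit makes this closed under products even when some factors are units;
    [factorableP] absorbs it into an irreducible factor. *)
Definition factorable x := exists u (fs : seq A),
  [/\ is_unit u, {in fs, forall f, irreducible f} & x = u * \prod_(f <- fs) f].

Lemma factorable_unit x : is_unit x -> factorable x.
Proof. by move=> ux; exists x, [::]; rewrite big_nil mulr1. Qed.

Lemma factorable_irreducible x : irreducible x -> factorable x.
Proof.
move=> irrx; exists 1, [:: x]; split; first exact: is_unit1.
  by move=> f; rewrite inE => /eqP->.
by rewrite big_seq1 mul1r.
Qed.

Lemma factorableM x y : factorable x -> factorable y -> factorable (x * y).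
Proof.
move=> [u [fs [uu irrfs ->]]] [v [gs [uv irrgs ->]]].
exists (u * v), (fs ++ gs); rewrite big_cat mulrACA; split=> //.
  exact: is_unitM.
by move=> f; rewrite mem_cat => /orP[/irrfs|/irrgs].
Qed.

Lemma factorable_prod (fs : seq A) :
  {in fs, forall f, irreducible f} -> factorable (\prod_(f <- fs) f).
Proof. by exists 1, fs; rewrite mul1r; split=> //; apply: is_unit1. Qed.

Lemma factorableP x : ~ is_unit x -> factorable x ->
  exists2 fs : seq A, {in fs, forall f, irreducible f} & x = \prod_(f <- fs) f.
Proof.
move=> nux [u [[|f fs] [uu irrfs xE]]].
  by case: nux; rewrite xE big_nil mulr1.
exists (u * f :: fs); last by rewrite xE !big_cons mulrA.
move=> h; rewrite inE => /predU1P[->|hfs]; last by apply: irrfs; rewrite inE hfs orbT.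
by apply: irreducible_mul_unit => //; apply: irrfs; rewrite mem_head.
Qed.

Hypothesis A_dom : GRing.integral_domain_axiom A.

Lemma domain_mulIf x y z : z <> 0 -> x * z = y * z -> x = y.
Proof.
move=> z0 xyz; have /A_dom : (x - y) * z = 0 by rewrite mulrBl xyz subrr.
by case/orP=> /eqP; [move/subr0_eq|].
Qed.

(** A nonzero element without factorization is a product of two nonunits, one of
    which has no factorization either; iterating gives a chain of proper divisors
    that never stabilizes. *)
Lemma accp_factorable x : x <> 0 -> accp_elt x -> factorable x.
Proof.
move=> x0 /accp_eltP x_accp; apply: contrapT => nfx.
pose bad y := y <> 0 /\ ~ factorable y.
have step y : exists z, bad y -> bad z /\ exists2 w, ~ is_unit w & y = w * z.
  have [[y0 nfy]|] := pselect (bad y); last by exists 0.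
  have [w [z [yE nuw nuz]]] : exists w z, [/\ y = w * z, ~ is_unit w & ~ is_unit z].
    apply: contrapT => nwz; apply: nfy; have [|nuy] := pselect (is_unit y).
      exact: factorable_unit.
    apply: factorable_irreducible; split=> // w z yE; apply: contrapT => nwz'.
    by apply: nwz; exists w, z; split=> // ?; apply: nwz'; [left|right].
  have z0 : z <> 0 by move=> z0; apply: y0; rewrite yE z0 mulr0.
  have w0 : w <> 0 by move=> w0; apply: y0; rewrite yE w0 mul0r.
  (* As y is not factorable, one of w and z is not. *)
  have [fz|nfz] := pselect (factorable z); last first.
    by exists z => _; split=> //; exists w.
  exists w => _; split; last by exists z; rewrite // mulrC.
  by split=> // fw; apply: nfy; rewrite yE; apply: factorableM.
have [next nextP] := choice step.
have badP n : bad (iter n next x) by elim: n => // n /nextP[].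
have [||N xN] := x_accp (fun n => iter n next x).
- exact: divides_refl.
- by move=> n; have [_ [w _ xE]] := nextP _ (badP n); exists w.
have [_ [w nuw xE]] := nextP _ (badP N).
have [t xtE] := xN N (leqnn N); apply: nuw; exists t.
apply: (domain_mulIf (badP N.+1).1).
by rewrite mul1r -mulrA -xE.
Qed.

End Divisibility.

Lemma idomain_axiom (R : idomainType) : GRing.integral_domain_axiom R.
Proof. by move=> x y /eqP; rewrite mulf_eq0. Qed.

(** * Greatest and least monomials *)

Section ExtremalMonomials.
Variables (R : idomainType) (M : conomType).
Hypothesis M_canc : mcancellative M.
Implicit Types (le : M -> M -> Prop) (a b m : M) (f g h : {malg R[M]}).

(** The greatest monomial of f, or the least one when [le] is a reversed order. *)
Definition extremal le f m := m \in msupp f /\ {in msupp f, forall k, le k m}.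

Lemma extremal_exists le f : monoid_order le ->
  (forall x y, le x y \/ le y x) -> f <> 0 -> exists m, extremal le f m.
Proof.
move=> leO le_tot f0.
have ex (s : seq M) : s != [::] -> exists2 m, m \in s & {in s, forall k, le k m}.
  elim: s => // x [_ _|y s /(_ isT)[m ms mmax] _].
    exists x; first by rewrite mem_head.
    by move=> k; rewrite inE => /eqP->; case: (le_tot x x).
  have [xm|mx] := le_tot x m.
    exists m; first by rewrite inE ms orbT.
    by move=> k; rewrite inE => /predU1P[->|/mmax].
  exists x; first by rewrite mem_head.
  move=> k; rewrite inE => /predU1P[->|/mmax km]; last exact: (mo_trans leO km).
  by case: (le_tot x x).
have [|m ms mmax] := ex (enum_fset (msupp f)); last by exists m.
apply: contra_notN f0 => /eqP f0; apply/eqP; rewrite -msupp_eq0.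
by apply/eqP/fsetP => k; rewrite !inE -[k \in _]/(k \in enum_fset _) f0.
Qed.

Lemma extremal_unique le f a b : monoid_order le ->
  extremal le f a -> extremal le f b -> a = b.
Proof.
by move=> leO [af amax] [bf bmax]; apply: (mo_anti leO); [apply: bmax|apply: amax].
Qed.

(** The extremal monomial a * b arises in the product only from the pair (a, b),
    so no cancellation can occur there. *)
Lemma mcoeffM_extremal le f g a b : monoid_order le ->
  extremal le f a -> extremal le g b -> (f * g)@_(a * b)%M = f@_a * g@_b.
Proof.
move=> leO [af amax] [bg bmax].
have abE : {in msupp f & msupp g, forall k l,
    (k * l == a * b)%M = (k == a) && (l == b)}.
  move=> k l kf lg; apply/eqP/andP => [klE|[/eqP-> /eqP->]//].
  have lb : l = b.
    apply: (M_canc (b := a)); apply: (mo_anti leO).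
      by apply: (mo_mul leO); apply: bmax.
    by rewrite -klE mulmC [(a * l)%M]mulmC; apply: (mo_mul leO); apply: amax.
  by split; apply/eqP => //; apply: (M_canc (b := b)); rewrite -[in LHS]lb mulmC klE mulmC.
rewrite mcoeffMl (big_fsetD1 a) //= (big_fsetD1 b) //= eqxx.
rewrite !big1_fset ?addr0 // => [k /fsetD1P[ka kf] _|l /fsetD1P[lb lg] _].
  by rewrite big1_fset // => l lg _; rewrite abE // (negbTE ka).
by rewrite abE // (negbTE lb) andbF.
Qed.

Lemma extremalM le f g a b : monoid_order le ->
  extremal le f a -> extremal le g b -> extremal le (f * g) (a * b)%M.
Proof.
move=> leO fa gb; split.
  rewrite -mcoeff_neq0 (mcoeffM_extremal leO fa gb) mulf_neq0 ?mcoeff_neq0 //.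
  - exact: fa.1.
  - exact: gb.1.
move=> _ /msuppM_le[k [l [kf lg ->]]].
by apply: (monoid_order_mul2 leO); [apply: fa.2|apply: gb.2].
Qed.

Lemma malg_const_extremal le f : monoid_order le ->
  extremal le f 1%M -> extremal (fun x y => le y x) f 1%M -> f = (f@_1%M)%:MP.
Proof.
move=> leO [_ fmax] [_ fmin]; apply/malgP => k; rewrite mcoeffC.
have [->|k1] := eqVneq k 1%M; first by rewrite mulr1n.
apply: mcoeff_outdom; apply: contra k1 => kf; apply/eqP.
by apply: (mo_anti leO); [apply: fmax|apply: fmin].
Qed.

(** The extremal monomials t_n of a_n satisfy t_n = u_n * t_(n+1) with u_n that
    of h_n; once t_n is stable, cancellation forces u_n = 1. *)
Lemma extremal_quotients_stable le (a h : nat -> {malg R[M]}) :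
    maccp M -> monoid_order le -> (forall x y, le x y \/ le y x) ->
    (forall n, a n <> 0) -> (forall n, a n = h n * a n.+1) ->
  exists N, forall n, (N <= n)%N -> extremal le (h n) 1%M.
Proof.
move=> M_accp leO le_tot a0 aE.
have h0 n : h n <> 0 by move=> hn0; apply: (a0 n); rewrite aE hn0 mul0r.
have [t at_] := choice (fun n => extremal_exists leO le_tot (a0 n)).
have [u hu] := choice (fun n => extremal_exists leO le_tot (h0 n)).
have tE n : t n = (u n * t n.+1)%M.
  apply: (extremal_unique leO (at_ n)).
  by rewrite aE; apply: (extremalM leO).
have [|N tN] := maccp_stable M_canc M_accp (t := t).
  by move=> n; exists (u n); rewrite tE mulmC.
exists N => n /tN tn; suff <- : u n = 1%M by [].
by apply: (M_canc (b := t n)); rewrite mulm1 mulmC [RHS]tE tn.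
Qed.

End ExtremalMonomials.

(** * Transfer between R and R[M] *)

Section MonoidRings.
Variables (R : idomainType) (M : conomType).
Hypothesis M_canc : mcancellative M.
Hypothesis M_tf : mtorsion_free M.
Implicit Types (c d s : R) (f g h : {malg R[M]}).

Lemma malg_domain : GRing.integral_domain_axiom {malg R[M]}.
Proof.
move=> f g fg0; apply: contraT; rewrite negb_or => /andP[/eqP f0 /eqP g0].
have [le leO le_tot] := total_monoid_order M_canc M_tf.
have [a fa] := extremal_exists leO le_tot f0.
have [b gb] := extremal_exists leO le_tot g0.
by have [] := extremalM M_canc leO fa gb; rewrite fg0 msupp0 inE.
Qed.

(** The greatest monomials of the two factors multiply to 1, hence are 1 as M is
    reduced; the least ones are 1 for the same reason. *)
Lemma malg_mul_const f g c : c <> 0 -> f * g = c%:MP ->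
  f = (f@_1%M)%:MP /\ g = (g@_1%M)%:MP.
Proof.
move=> c0 fgc.
have fg0 : f * g <> 0.
  by rewrite fgc => /eqP; rewrite monalgU_eq0 => /eqP.
have f0 : f <> 0 by move=> f0; apply: fg0; rewrite f0 mul0r.
have g0 : g <> 0 by move=> g0; apply: fg0; rewrite g0 mulr0.
have ext1 le : monoid_order le -> (forall x y, le x y \/ le y x) ->
    extremal le f 1%M /\ extremal le g 1%M.
  move=> leO le_tot.
  have [a fa] := extremal_exists leO le_tot f0.
  have [b gb] := extremal_exists leO le_tot g0.
  have [abc _] := extremalM M_canc leO fa gb.
  suff [a1 b1] : a = 1%M /\ b = 1%M by rewrite -{1}a1 -b1.
  apply: unitm; move: abc; rewrite fgc => /(fsubsetP (msuppC_le _)).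
  by rewrite inE => /eqP.
have [le leO le_tot] := total_monoid_order M_canc M_tf.
have [f1 g1] := ext1 _ leO le_tot.
have [f1' g1'] := ext1 _ (monoid_order_dual leO) (fun x y => le_tot y x).
by split; apply: malg_const_extremal leO _ _.
Qed.

Lemma divides_malgC c d : divides c%:MP (d%:MP : {malg R[M]}) <-> divides c d.
Proof.
split=> [[f /(congr1 (mcoeff 1%M))]|[t ->]]; last first.
  by exists t%:MP; rewrite -mpolyCM.
by rewrite rmorphM /= !malgCK => ->; exists f@_1%M.
Qed.

Lemma is_unit_malgC c : is_unit (c%:MP : {malg R[M]}) <-> is_unit c.
Proof.
rewrite /is_unit; split=> [[f /(congr1 (mcoeff 1%M))]|[t tc]].
  by rewrite rmorphM rmorph1 /= malgCK => fc; exists f@_1%M.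
by exists t%:MP; rewrite -mpolyCM tc.
Qed.

Lemma malgC_neq0 c : (c%:MP : {malg R[M]}) <> 0 <-> c <> 0.
Proof.
by split=> c0 /eqP; [rewrite -(monalgU_eq0 c (1%M : M))|rewrite monalgU_eq0] => /eqP.
Qed.

Lemma irreducible_malgC c : irreducible (c%:MP : {malg R[M]}) <-> irreducible c.
Proof.
split=> -[c0 nuc irrc]; split.
- exact/malgC_neq0.
- by move/is_unit_malgC.
- move=> y z cE; have [|/is_unit_malgC|/is_unit_malgC] := irrc y%:MP z%:MP.
  + by rewrite cE mpolyCM.
  + by left.
  + by right.
- exact/malgC_neq0.
- by move/is_unit_malgC.
- move=> f g fgc; have [fC gC] := malg_mul_const c0 (esym fgc).
  rewrite fC gC; have [||] := irrc f@_1%M g@_1%M.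
  + by move/(congr1 (mcoeff 1%M)): fgc; rewrite rmorphM /= malgCK.
  + by left; apply/is_unit_malgC.
  + by right; apply/is_unit_malgC.
Qed.

Lemma factorable_malgC c : factorable c -> factorable (c%:MP : {malg R[M]}).
Proof.
move=> [u [fs [uu irrfs ->]]]; rewrite mpolyCM.
apply: factorableM; first by apply: factorable_unit; apply/is_unit_malgC.
rewrite rmorph_prod /= -(big_map (fun x => x%:MP) xpredT id).
apply: factorable_prod => _ /mapP[f ffs ->].
by apply/irreducible_malgC/irrfs.
Qed.

Lemma accp_elt_malgC c : accp_elt (c%:MP : {malg R[M]}) -> accp_elt c.
Proof.
move=> /accp_eltP cC; apply/accp_eltP => a ac a_dec.
have [||N aN] := cC (fun n => (a n)%:MP).
- exact/divides_malgC.
- by move=> n; apply/divides_malgC.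
by exists N => n /aN /divides_malgC.
Qed.

(** The transfer principle. The coefficient s of g need not persist in the
    divisors of g, but constants dividing g divide all its coefficients: this
    turns the eventually constant quotients of a chain below g into the quotients
    of a chain below s. *)
Lemma accp_elt_coef g m : maccp M ->
  g@_m <> 0 -> accp_elt g@_m -> accp_elt g.
Proof.
move=> M_accp gm0 /accp_eltP gm_accp; apply/accp_eltP => a [k gE] a_dec.
have [h aE] := choice a_dec.
have a0 n : a n <> 0.
  elim: n => [a0|n IHn an0]; first by apply: gm0; rewrite gE a0 mulr0 mcoeff0.
  by apply: IHn; rewrite aE an0 mulr0.
have [le leO le_tot] := total_monoid_order M_canc M_tf.
have [N1 hN1] := extremal_quotients_stable M_canc M_accp leO le_tot a0 aE.
have [N2 hN2] := extremal_quotients_stable M_canc M_accp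
  (monoid_order_dual leO) (fun x y => le_tot y x) a0 aE.
pose N := maxn N1 N2; pose c n := (h (N + n)%N)@_1%M.
have hC n : h (N + n)%N = (c n)%:MP.
  apply: (malg_const_extremal leO).
    by apply: hN1; rewrite (leq_trans (leq_maxl N1 N2)) ?leq_addr.
  by apply: hN2; rewrite (leq_trans (leq_maxr N1 N2)) ?leq_addr.
have [k' gE'] : exists k', g = k' * a N.
  elim: N {c hC} => [|n [k' ->]]; first by exists k.
  by exists (k' * h n); rewrite aE mulrA.
(* The chain in R: b 0 = g@_m, and the quotients are the constants c n. *)
pose b n := (k' * a (N + n)%N)@_m.
have bE n : b n = c n * b n.+1.
  by rewrite /b aE hC mulrCA mcoeffCM addnS.
have b00 : b 0%N = g@_m by rewrite /b addn0 gE'.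
have b0 n : b n <> 0.
  elim: n => [|n IHn bn0]; first by rewrite b00.
  by apply: IHn; rewrite bE bn0 mulr0.
have [||N' bN'] := gm_accp b.
- by rewrite b00; apply: divides_refl.
- by move=> n; exists (c n).
exists (N + N')%N => n Nn.
have NnE : n = (N + (n - N))%N by rewrite subnKC // (leq_trans _ Nn) ?leq_addr.
move: (n - N)%N NnE => j nE; move: Nn; rewrite {n}nE leq_add2l => /bN'[t tE].
have tc : t * c j = 1.
  by apply: (domain_mulIf (@idomain_axiom R) (b0 j.+1)); rewrite mul1r -mulrA -bE.
by exists t%:MP; rewrite [a (N + j)%N]aE hC mulrA -mpolyCM tc mpolyC1E mul1r.
Qed.

Lemma divides_coef d f :
  {in msupp f, forall k, divides d f@_k} -> divides d%:MP f.
Proof.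
move=> d_dvd.
have quotient_at k : exists x, f@_k = x * d.
  by have [/d_dvd[t ->]|_] := msuppP; [exists t|exists 0; rewrite mul0r].
have [q qE] := choice quotient_at.
exists (\sum_(k <- msupp f) << q k *g k >>).
rewrite mulrC mul_malgC scaler_sumr [LHS]monalgE; apply: eq_bigr => k _.
by apply/malgP => l; rewrite !mcoeffsE qE mulrC mulrnAr.
Qed.

(** A common divisor in R of all the coefficients of all the elements of S serves
    for S in R[M]: by [accp_elt_coef], a single quotient coefficient satisfying
    ACCP is enough. *)
Lemma weak_accp_content (S : {fset {malg R[M]}}) : maccp M -> weak_accp R ->
    S != fset0 -> 0 \notin S ->
  exists d, {in S, forall f, divides d%:MP f} /\
    exists f g, [/\ f \in S, f = g * d%:MP & accp_elt g].
Proof.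
move=> M_accp [_ _ R_wa] S0 nS0.
pose C := seq_fset tt (flatten [seq [seq f@_k | k <- msupp f] | f <- S]).
have CP c : reflect (exists f k, [/\ f \in S, k \in msupp f & c = f@_k]) (c \in C).
  rewrite seq_fsetE; apply: (iffP flatten_mapP) => [[f fS /mapP[k kf ->]]|].
    by exists f, k.
  by move=> [f [k [fS kf ->]]]; exists f => //; apply: map_f.
have [||d [d_dvd [s [t [/CP[f [k [fS kf ->]]] fkE t_accp]]]]] := R_wa C.
- have /fset0Pn[f fS] := S0; have f0 : f != 0 by apply: contraNneq nS0 => <-.
  move: f0; rewrite -msupp_eq0 => /fset0Pn[k kf]; apply/fset0Pn; exists f@_k.
  by apply/CP; exists f, k.
- by apply/CP => -[f [k [_ kf fk0]]]; move: kf; rewrite -mcoeff_neq0 -fk0 eqxx.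
have dS : {in S, forall f, divides d%:MP f}.
  by move=> f' f'S; apply: divides_coef => l lf'; apply: d_dvd; apply/CP; exists f', l.
exists d; split=> //; have [g fE] := dS _ fS; exists f, g; split=> //.
have fk0 : f@_k <> 0 by apply/eqP; rewrite mcoeff_neq0.
have gkd : f@_k = g@_k * d by rewrite {1}fE mulrC mcoeffCM mulrC.
have d0 : d <> 0 by move=> d0; apply: fk0; rewrite gkd d0 mulr0.
apply: (accp_elt_coef (m := k)) => //.
  by move=> gk0; apply: fk0; rewrite gkd gk0 mul0r.
by rewrite (domain_mulIf (@idomain_axiom R) (x := g@_k) (y := t) d0) // -gkd.
Qed.

Lemma weak_accp_malg : maccp M -> weak_accp R -> weak_accp {malg R[M]}.
Proof.
move=> M_accp R_wa; split; first exact: malg_domain.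
  move=> f f0 nuf; apply: factorableP => //.
  have [||d [_ [_ [g [/fset1P-> fE g_accp]]]]] :=
    weak_accp_content (S := [fset f]%fset) M_accp R_wa.
  - by apply/fset0Pn; exists f; apply: fset11.
  - by rewrite in_fset1 eq_sym; apply/eqP.
  rewrite fE; apply: factorableM.
    by apply: (accp_factorable malg_domain) => // g0; apply: f0; rewrite fE g0 mul0r.
  apply: factorable_malgC; have d0 : d <> 0.
    by move=> d0; apply: f0; rewrite fE d0 malgC0E mulr0.
  have [|nud] := pselect (is_unit d); first exact: factorable_unit.
  have [_ R_at _] := R_wa; have [fs irrfs ->] := R_at d d0 nud.
  exact: factorable_prod.
move=> S S0 nS0; have [d [dS [f [g [fS fE g_accp]]]]] := weak_accp_content M_accp R_wa S0 nS0.
by exists d%:MP; split=> //; exists f, g.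
Qed.

Lemma malg_factors_const (fs : seq {malg R[M]}) c :
  c <> 0 -> \prod_(f <- fs) f = c%:MP ->
  {in fs, forall f, f = (f@_1%M)%:MP}.
Proof.
move=> c0 fsc f ffs; move: fsc; rewrite (big_rem f) //=.
by case/(malg_mul_const c0).
Qed.

Lemma weak_accp_coef : weak_accp {malg R[M]} -> weak_accp R.
Proof.
move=> [_ A_at A_wa]; split; first exact: idomain_axiom.
  move=> c c0 nuc; have [||fs irrfs cE] := A_at c%:MP.
  - exact/malgC_neq0.
  - by move/is_unit_malgC.
  have fsC := malg_factors_const c0 (esym cE).
  exists [seq f@_1%M | f <- fs].
    move=> _ /mapP[f ffs ->]; apply/irreducible_malgC.
    by rewrite -fsC //; apply: irrfs.
  by move/(congr1 (mcoeff 1%M)): cE; rewrite malgCK rmorph_prod big_map.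
move=> S S0 nS0.
have [||d [dS [_ [t [/imfsetP[/= s sS ->] sE t_accp]]]]] :=
  A_wa [fset (c%:MP : {malg R[M]}) | c in S]%fset.
- have /fset0Pn[s sS] := S0; apply/fset0Pn; exists s%:MP.
  by apply/imfsetP; exists s.
- apply/imfsetP => -[/= s sS /esym/eqP]; rewrite monalgU_eq0 => /eqP s0.
  by move: nS0; rewrite -s0 sS.
have s0 : s <> 0 by move=> s0; move: nS0; rewrite -s0 sS.
have [tC dC] := malg_mul_const s0 (esym sE).
exists d@_1%M; split.
  move=> s' s'S; apply/divides_malgC; rewrite -dC.
  by apply: dS; apply/imfsetP; exists s'.
exists s, t@_1%M; split=> //.
  by move/(congr1 (mcoeff 1%M)): sE; rewrite malgCK rmorphM.
by apply: accp_elt_malgC; rewrite -tC.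
Qed.

End MonoidRings.

Theorem proposition5p1 (R : idomainType) (M : conomType)
    (M_canc : mcancellative M) (M_tf : mtorsion_free M) (M_accp : maccp M) :
  weak_accp R <-> weak_accp {malg R[M]}.
Proof.
by split; [apply: weak_accp_malg|apply: weak_accp_coef].
Qed.
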